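(* Let $d\ge 3$ and let ${\rm F}_d\subset\mathbb{P}^3(\mathbb{C})$ be the Fermat surface $x^d-y^d-z^d+w^d=0$. Let $\mathfrak{s}({\rm F}_d)$ denote the maximal number of pairwise disjoint lines contained in ${\rm F}_d$. Then $\mathfrak{s}({\rm F}_d)=3d$ for all $d\ge 3$ with $d\neq 3,5$, while $\mathfrak{s}({\rm F}_3)=6$ and $\mathfrak{s}({\rm F}_5)=13$.
   Context: Lines are projective lines in $\mathbb{P}^3(\mathbb{C})$; ''pairwise disjoint'' (skew) means no two of them intersect. *)

(* Defs.v *)
(* The complex numbers are modelled as R[i] = complex R for
   an arbitrary R : realType (any such R is isomorphic to the real numbers). *)
From HB Require Import structures.
From mathcomp Require Import all_boot all_order all_algebra.
From mathcomp Require Import complex.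
From mathcomp Require Import reals.
Set Implicit Arguments. Unset Strict Implicit. Unset Printing Implicit Defensive.
Import Order.TTheory GRing.Theory Num.Theory.
Local Open Scope ring_scope.

Section Fermat.
Variable R : realType.
Notation C := (R[i]).

(* Homogeneous coordinates (x,y,z,w) of a point of P^3(C) : a row vector of C^4. *)
Definition fermat_poly (d : nat) (p : 'rV[C]_4) : C :=
  p 0 (inord 0) ^+ d - p 0 (inord 1) ^+ d - p 0 (inord 2) ^+ d + p 0 (inord 3) ^+ d.

(* A projective line of P^3(C) is the projectivisation of a 2-dimensional
   subspace of C^4, given here as the row space of a rank-2 2x4 matrix. *)
Definition is_line (L : 'M[C]_(2,4)) : Prop := \rank L = 2%N.

Definition line_on_Fermat (d : nat) (L : 'M[C]_(2,4)) : Prop :=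
  forall v : 'rV[C]_4, (v <= L)%MS -> fermat_poly d v = 0.

Definition skew (L1 L2 : 'M[C]_(2,4)) : Prop := \rank (L1 :&: L2)%MS = 0%N.

Definition has_skew_lines (d n : nat) : Prop :=
  exists L : 'I_n -> 'M[C]_(2,4),
    (forall i, is_line (L i) /\ line_on_Fermat d (L i)) /\
    (forall i j, i != j -> skew (L i) (L j)).

Definition max_skew_lines (d s : nat) : Prop :=
  has_skew_lines d s /\ (forall n, has_skew_lines d n -> (n <= s)%N).
End Fermat.

(* Main.v *)
Require Import Defs.
From HB Require Import structures.
From mathcomp Require Import all_boot all_order all_algebra.
From mathcomp Require Import complex reals.
From mathcomp Require Import cyclic separable cyclotomic.
From mathcomp Require Import zify ring.

(** Restricted to a line, the four coordinates are binary linear forms whose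
    signed [d]-th powers cancel.  Since [d >= 3], multiplying at most three linear
    forms gives a degree [d] polynomial that isolates one proportionality class,
    so the coordinates are proportional in two pairs and the ratios are [d]-th
    roots of [1] or [-1].  The [3 d^2] lines are thus coded by one of the three
    pairings and two exponents [a, b] modulo [d].  Two lines of the same pairing
    are skew when both exponents differ, so each pairing carries at most [d]
    pairwise skew lines, a full set of [d] being the graph of a permutation; for
    lines of different pairings, meeting means that a prescribed form, [a - b] or
    [a + b] up to a shift, takes the same value on both.

    For [d = 5] a permutation takes at least 3 values of [a - b] unless [a + b]
    takes all 5, and vice versa, so two full pairings exclude the third; for
    [d = 3] one of the two forms is already surjective.  For even [d] the bound
    [3 d] is reached by affine permutations, and for odd [d] other than
    3, 5, 7, 11 by reversing three intervals of odd length: then [a - b] takes three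
    values and [a + b] runs over integers of one parity in a short interval. *)

Set Implicit Arguments.
Unset Strict Implicit.
Unset Printing Implicit Defensive.
Import Order.TTheory GRing.Theory Num.Theory.

(** * Codes of lines *)

Inductive pairing := XY | XZ | XW.

Definition pairing_ord (f : pairing) : 'I_3 :=
  match f with XY => ord0 | XZ => lift ord0 ord0 | XW => ord_max end.

Definition ord_pairing (i : 'I_3) : pairing :=
  match val i with 0 => XY | 1 => XZ | _ => XW end.

Lemma pairing_ordK : cancel pairing_ord ord_pairing.
Proof. by case. Qed.

HB.instance Definition _ := Finite.copy pairing (can_type pairing_ordK).

Lemma card_pairing : #|{: pairing}| = 3.
Proof.
apply/eqP; rewrite eqn_leq; apply/andP; split.
  by rewrite -[leqRHS](card_ord 3); apply: leq_card (can_inj pairing_ordK).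
have /card_uniqP/= <- : uniq [:: XY; XZ; XW] by [].
exact: max_card.
Qed.

Lemma sum_pairing (F : pairing -> nat) : \sum_f F f = F XY + F XZ + F XW.
Proof.
rewrite (bigD1 XY) // (bigD1 XZ) //= (bigD1 XW) //= big1 ?addn0 ?addnA //.
by case.
Qed.

(* [(f, a, b)] codes the line on which the coordinates paired by [f] have ratios
   the [a]-th and [b]-th power of a primitive [d]-th root of unity, both
   multiplied, when [f = XW], by a square root of that root. *)
Definition code := (pairing * nat * nat)%type.

(* Equating the ratios around the four coordinates shows that these are the
   conditions for the two lines to meet. *)
Definition meets (d : nat) (c c' : code) : bool :=
  let: (f, a, b) := c in
  let: (f', a', b') := c' in
  match f, f' with
  | XY, XZ => a + b' == a' + b %[mod d]
  | XZ, XY => a' + b == a + b' %[mod d]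
  | XY, XW => a + b + b' == a' %[mod d]
  | XW, XY => a' + b' + b == a %[mod d]
  | XZ, XW => a + b == a' + b' + 1 %[mod d]
  | XW, XZ => a' + b' == a + b + 1 %[mod d]
  | _, _ => (a == a' %[mod d]) || (b == b' %[mod d])
  end.

Arguments meets : simpl never.

Lemma meets_sym d : symmetric (meets d).
Proof.
by move=> [[[] a] b] [[[] a'] b']; rewrite /meets // (eq_sym (a %% d)) (eq_sym (b %% d)).
Qed.

Lemma meets_same d f a b a' b' :
  meets d (f, a, b) (f, a', b') = (a == a' %[mod d]) || (b == b' %[mod d]).
Proof. by case: f. Qed.

(** * Explicit families of pairwise skew codes *)

Definition skew_codes (d n : nat) : Prop :=
  exists c : 'I_n -> code, forall i j, i != j -> ~~ meets d (c i) (c j).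

Lemma skew_codes_seq d (s : seq code) :
  pairwise (fun c c' => ~~ meets d c c') s -> skew_codes d (size s).
Proof.
move=> s_skew; exists (fun i => nth (XY, 0, 0) s i) => i j neq_ij.
wlog lt_ij : i j neq_ij / i < j.
  move=> IH; move: (neq_ij); rewrite neq_ltn => /orP[/IH->//|/IH].
  by rewrite meets_sym eq_sym => ->.
by move/(pairwiseP (XY, 0, 0)): s_skew; apply; rewrite ?inE.
Qed.

(** Each pairing carries the graph of [s f]: two codes of one graph have different first exponents,
    and injectivity of [s f] modulo [d] separates the second ones. *)
Lemma skew_codes_perm d (s : pairing -> nat -> nat) :
  (forall f a a', a < d -> a' < d -> s f a = s f a' %[mod d] -> a = a') ->
  (forall f g a a', a < d -> a' < d -> f != g ->
     ~~ meets d (f, a, s f a) (g, a', s g a')) ->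
  skew_codes d (3 * d).
Proof.
move=> s_inj s_skew.
have cardT : #|{: pairing * 'I_d}| = 3 * d by rewrite card_prod card_pairing card_ord.
pose t (i : 'I_(3 * d)) := enum_val (cast_ord (esym cardT) i).
exists (fun i => ((t i).1, val (t i).2, s (t i).1 (t i).2)) => i j neq_ij.
have : t i != t j by apply: contra_neq neq_ij => /enum_val_inj/cast_ord_inj.
case: (t i) (t j) => f a [g a'] /=; rewrite xpair_eqE.
case: (eqVneq f g) => [<- /= neq_a|neq_fg _]; last exact: s_skew.
rewrite meets_same; apply: contra neq_a => /orP[|/eqP eq_s].
  by rewrite !modn_small.
by apply/eqP/val_inj; apply: s_inj eq_s.
Qed.

(** Makes the quotient explicit, so that congruences become equations for [lia] and [nia]. *)
Lemma eqn_mod_cases d x y : x = y %[mod d] ->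
  exists k, x = y + k * d \/ y = x + k * d.
Proof.
move=> eq_xy; case: (leqP y x) => [le_yx|/ltnW le_xy].
  have /dvdnP[k Dk] : d %| x - y by rewrite -eqn_mod_dvd // eq_xy.
  by exists k; left; rewrite -Dk subnKC.
have /dvdnP[k Dk] : d %| y - x by rewrite -eqn_mod_dvd // eq_xy.
by exists k; right; rewrite -Dk subnKC.
Qed.

(** The graphs are [b = a], [b = 1 - a] and [b = a + 1] modulo [d]. For each two of them, meeting
    would make an odd number congruent to an even one, which an even [d] forbids. *)
Lemma skew_codes_even d : ~~ odd d -> skew_codes d (3 * d).
Proof.
move=> d_even; apply: (@skew_codes_perm d
  (fun f a => match f with XY => a | XZ => d.+1 - a | XW => a.+1 end)).
  by move=> [] a a' lt_a lt_a' /eqn_mod_cases[[|[|k]]] []; nia.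
have dD : d = d./2.*2 by rewrite -[LHS]odd_double_half (negbTE d_even).
by move=> [] [] // a a' lt_a lt_a' _; apply/eqP => /eqn_mod_cases[k] []; nia.
Qed.

(* Reverses the order of three consecutive intervals of lengths [m1], [m2], [m3]. *)
Definition rev3 (m1 m2 m3 a : nat) : nat :=
  if a < m1 then a + m2 + m3
  else if a < m1 + m2 then a + m3 - m1 else a - (m1 + m2).

Lemma rev3_inj d m1 m2 m3 s a a' : d = m1 + m2 + m3 -> a < d -> a' < d ->
  rev3 m1 m2 m3 a + s = rev3 m1 m2 m3 a' + s %[mod d] -> a = a'.
Proof.
move=> -> lt_a lt_a' /eqP; rewrite eqn_modDr => /eqP.
have rev3_lt x : x < m1 + m2 + m3 -> rev3 m1 m2 m3 x < m1 + m2 + m3.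
  by rewrite /rev3; do 2?case: ifP; lia.
by rewrite !modn_small ?rev3_lt // /rev3; do 4?case: ifP; lia.
Qed.

(** Modulo [d], [a - b] takes the values [m, 2m, 3m] on [XY], the same minus 2 on [XZ], and
    [m, 0, -m-2] on [XW]; no two of the first three differ by 2. By [d <= 3 * m], the integer
    [a + b] is even in [[d-m, d+m-2]] on [XY] and even in [[d-m+2, d+m]] on [XZ], while [a + b + 1]
    is odd in [[d-m+1, d+m+3]] on [XW]. Integers of opposite parity less than [d] apart are
    incongruent, and the even representatives [d+m], [0], [d-m-2] of the [XW] differences miss the
    [XY] range. *)
Lemma skew_codes_odd d m :
  odd d -> odd m -> d <= 3 * m -> 2 * m + 2 < d -> skew_codes d (3 * d).
Proof.
move=> d_odd m_odd le_d lt_d; apply: (@skew_codes_perm d (fun f a =>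
  match f with
  | XY => rev3 m m (d - 2 * m) a + 0
  | XZ => rev3 m m (d - 2 * m) a + 2
  | XW => rev3 (m + 2) (d - 2 * m - 2) m a + 2
  end)).
  by case=> a a' lt_a lt_a' /rev3_inj; apply; lia.
have dD := odd_double_half d; have mD := odd_double_half m.
rewrite d_odd in dD; rewrite m_odd in mD.
by move=> [] [] // a a' lt_a lt_a' _; apply/eqP => /eqn_mod_cases[[|[|[|[|k]]]]];
   rewrite /rev3; do 4?case: ifP; first [lia | nia].
Qed.

Definition perm_codes (f : pairing) (s : seq nat) : seq code :=
  [seq (f, i, nth 0 s i) | i <- iota 0 (size s)].

Lemma skew_codes_7 : skew_codes 7 (3 * 7).
Proof.
apply: (@skew_codes_seq 7 (perm_codes XY [:: 1; 0; 3; 2; 5; 4; 6] ++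
  perm_codes XZ [:: 3; 5; 4; 0; 6; 1; 2] ++
  perm_codes XW [:: 3; 5; 6; 0; 4; 1; 2])).
by vm_compute.
Qed.

Lemma skew_codes_11 : skew_codes 11 (3 * 11).
Proof.
apply: (@skew_codes_seq 11 (perm_codes XY [:: 2; 9; 10; 0; 6; 7; 3; 4; 5; 8; 1] ++
  perm_codes XZ [:: 9; 1; 0; 10; 5; 8; 7; 2; 6; 4; 3] ++
  perm_codes XW [:: 7; 4; 8; 6; 10; 0; 9; 2; 3; 1; 5])).
by vm_compute.
Qed.

Lemma skew_codes_3 : skew_codes 3 6.
Proof.
apply: (@skew_codes_seq 3
  (perm_codes XY [:: 0; 1; 2] ++ perm_codes XZ [:: 1; 2; 0])).
by vm_compute.
Qed.

Lemma skew_codes_5 : skew_codes 5 13.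
Proof.
apply: (@skew_codes_seq 5 (perm_codes XY [:: 0; 1; 2; 4; 3] ++
  perm_codes XZ [:: 2; 3; 0; 1] ++
  [:: (XW, 0, 4); (XW, 1, 3); (XW, 3, 2); (XW, 4, 1)])).
by vm_compute.
Qed.

Lemma skew_codes_max d : 3 < d -> d != 5 -> skew_codes d (3 * d).
Proof.
move=> d_gt3 d_neq5; have [d_odd|d_even] := boolP (odd d); last exact: skew_codes_even.
have [->|d_neq7] := eqVneq d 7; first exact: skew_codes_7.
have [->|d_neq11] := eqVneq d 11; first exact: skew_codes_11.
(* This is the largest odd [m] with [2 * m + 2 < d]; among odd [d > 3], it violates [d <= 3 * m]
   only for 5, 7 and 11. *)
by apply: (@skew_codes_odd d ((d - 5) %/ 4).*2.+1); rewrite //= ?odd_double //; lia.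
Qed.

(** * Upper bounds *)

Section UpperBound.
Variables (d n : nat) (c : 'I_n -> code).
Hypothesis d_gt0 : 0 < d.
Hypothesis c_skew : forall i j, i != j -> ~~ meets d (c i) (c j).

Definition members (f : pairing) : {set 'I_n} := [set i | (c i).1.1 == f].

Lemma sum_members : #|members XY| + #|members XZ| + #|members XW| = n.
Proof.
rewrite -(sum_pairing (fun f => #|members f|)) -[RHS]card_ord -sum1_card.
rewrite (partition_big (fun i => (c i).1.1) xpredT) //=.
by apply: eq_bigr => f _; rewrite -sum1_card; apply: eq_bigl => i; rewrite inE.
Qed.

Lemma members_inj f i j : i \in members f -> j \in members f ->
  ((c i).1.2 == (c j).1.2 %[mod d]) || ((c i).2 == (c j).2 %[mod d]) -> i = j.
Proof.
rewrite !inE => /eqP fi /eqP fj; apply: contraTeq => /c_skew.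
by case: (c i) (c j) fi fj => [[g a] b] [[g' a'] b'] /= -> ->; rewrite meets_same.
Qed.

Definition slope (i : 'I_n) : 'I_d := Ordinal (ltn_pmod (c i).1.2 d_gt0).

Lemma slope_inj f : {in members f &, injective slope}.
Proof. by move=> i j fi fj [] /eqP eq_ij; apply: (members_inj fi fj); rewrite eq_ij. Qed.

Lemma card_members f : #|members f| <= d.
Proof.
rewrite -(card_in_imset (@slope_inj f)) -[leqRHS]card_ord.
exact: max_card.
Qed.

(** By counting, the first exponent takes each residue exactly once, so the second is a function of
    it, injective again by skewness; [s] is its table. *)
Lemma full_members f : #|members f| = d ->
  exists2 s, perm_eq s (iota 0 d) & forall j, j < d ->
    exists2 i, i \in members f & (c i).1.2 = j %[mod d] /\ (c i).2 = nth 0 s j %[mod d].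
Proof.
move=> card_f.
have imT : slope @: members f = setT.
  apply/eqP; rewrite eqEcard subsetT cardsT card_ord.
  by rewrite (card_in_imset (@slope_inj f)) card_f /=.
(* The implication makes the choice function total: for [j >= d] any index serves, and one exists
   since [d > 0]. *)
have ex j : exists i, (j < d) ==> (i \in members f) && ((c i).1.2 %% d == j).
  have [lt_jd|_] := ltnP j d.
    have /imsetP[i fi Dj] : Ordinal lt_jd \in slope @: members f by rewrite imT.
    by exists i; rewrite fi -[j]/(val (Ordinal lt_jd)) Dj /=.
  have /card_gt0P[i _] : 0 < #|members f| by rewrite card_f.
  by exists i.
pose p j := xchoose (ex j).
have pP j : j < d -> (p j \in members f) /\ (c (p j)).1.2 %% d = j.
  by move=> lt_jd; have /implyP/(_ lt_jd)/andP[? /eqP] := xchooseP (ex j).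
exists (mkseq (fun j => (c (p j)).2 %% d) d); last first.
  move=> j lt_jd; have [fp Dj] := pP j lt_jd; exists (p j) => //.
  by rewrite nth_mkseq // modn_mod Dj modn_small.
have s_uniq : uniq (mkseq (fun j => (c (p j)).2 %% d) d).
  apply/mkseq_uniqP => j j' /pP[fj Dj] /pP[fj' Dj'] /eqP eq_b.
  by rewrite -Dj -Dj' (members_inj fj fj') ?eq_b ?orbT.
apply: uniq_perm; rewrite ?iota_uniq //.
apply: (uniq_min_size s_uniq _ _).2 => //; last by rewrite size_mkseq size_iota.
by move=> _ /mapP[j _ ->]; rewrite mem_iota /= ltn_pmod.
Qed.

Lemma leq_skew_codes : n <= 3 * d.
Proof.
rewrite -sum_members; have := card_members XY; have := card_members XZ.
by have := card_members XW; lia.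
Qed.

End UpperBound.

(* [form d f g] and [form d g f] take the same value on two codes exactly when
   the lines meet: up to a shift it is [a - b] or [a + b] modulo [d]. *)
Definition form (d : nat) (f g : pairing) (a b : nat) : nat :=
  match f, g with
  | XY, XW | XZ, XW => (a + b) %% d
  | XW, XZ => (a + b + 1) %% d
  | _, _ => (a + (d - b %% d)) %% d
  end.

(** [d - b %% d] stands for [-b] modulo [d], as subtraction on [nat] truncates. *)
Lemma eqn_mod_subr d x y b : 0 < d ->
  (x + b == y %[mod d]) = (x == y + (d - b %% d) %[mod d]).
Proof.
move=> d_gt0; rewrite -[in RHS](eqn_modDr b) -addnA.
suff e: d - b %% d + b = 0 %[mod d] by rewrite -[in RHS](modnDmr y) e mod0n addn0.
by rewrite -modnDmr subnK ?modnn ?mod0n // ltnW // ltn_pmod.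
Qed.

Lemma meets_form d f g a b a' b' : 0 < d -> f != g ->
  meets d (f, a, b) (g, a', b') = (form d f g a b == form d g f a' b').
Proof.
move=> d_gt0; have sub_swap x y u v :
    (x + u == y + v %[mod d]) = (x + (d - v %% d) == y + (d - u %% d) %[mod d]).
  by rewrite eqn_mod_subr // addnAC eq_sym [RHS]eq_sym eqn_mod_subr.
case: f g => [] [] // _; rewrite /meets /form.
- exact: sub_swap.
- exact: eqn_mod_subr.
- by rewrite sub_swap eq_sym.
- by rewrite eqn_mod_subr // eq_sym.
Qed.

Definition form_values (d : nat) (f g : pairing) (s : seq nat) : seq nat :=
  undup [seq form d f g j (nth 0 s j) | j <- iota 0 d].

Lemma form_lt d f g a b : 0 < d -> form d f g a b < d.
Proof. by move=> d_gt0; case: f g => [] []; apply: ltn_pmod. Qed.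

Lemma form_mod d f g a b a' b' : a = a' %[mod d] -> b = b' %[mod d] ->
  form d f g a b = form d f g a' b'.
Proof.
move=> eq_a eq_b; have eq_ab : a + b = a' + b' %[mod d].
  by rewrite -modnDm eq_a eq_b modnDm.
case: f g => [] [] //=; rewrite ?eq_b //.
all: by rewrite -[LHS]modnDml ?eq_a ?eq_ab modnDml.
Qed.

Section Full.
Variables (d n : nat) (c : 'I_n -> code).
Hypothesis d_gt0 : 0 < d.
Hypothesis c_skew : forall i j, i != j -> ~~ meets d (c i) (c j).

Let cP f i : i \in members c f -> c i = (f, (c i).1.2, (c i).2).
Proof. by rewrite inE; case: (c i) => [[? ?] ?] /= /eqP->. Qed.

Lemma form_neq f g i j : f != g -> i \in members c f -> j \in members c g ->
  form d f g (c i).1.2 (c i).2 != form d g f (c j).1.2 (c j).2.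
Proof.
move=> neq_fg fi gj; rewrite -meets_form // -(cP fi) -(cP gj); apply: c_skew.
by apply: contra_neq neq_fg => eq_ij; move: fi gj; rewrite eq_ij !inE => /eqP-> /eqP->.
Qed.

Definition forms_realized (f : pairing) (s : seq nat) : Prop :=
  forall g x, x \in form_values d f g s ->
    exists2 i, i \in members c f & form d f g (c i).1.2 (c i).2 = x.

(** Replaces a full family by a permutation from a finite list, which can be searched exhaustively
    once [d] is fixed. *)
Lemma full_form f : #|members c f| = d ->
  exists2 s, s \in permutations (iota 0 d) & forms_realized f s.
Proof.
case/(full_members d_gt0 c_skew) => s s_perm sP; exists s.
  by rewrite mem_permutations.
move=> g x; rewrite mem_undup => /mapP[j]; rewrite mem_iota => /= lt_jd ->.
by have [i fi [eq_a eq_b]] := sP j lt_jd; exists i => //; apply: form_mod.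
Qed.

Lemma size_form_values f g s : size (form_values d f g s) <= d.
Proof. by apply: leq_trans (size_undup _) _; rewrite size_map size_iota. Qed.

(* A form of a full family that takes every value forces the facing family to be empty. *)
Lemma size_form_values_lt f h s k : h != f ->
  forms_realized f s ->
  k \in members c h -> size (form_values d f h s) < d.
Proof.
move=> neq_hf sP hk; rewrite ltn_neqAle size_form_values andbT.
apply/eqP => sz_d; set x := form d h f (c k).1.2 (c k).2.
have x_in : x \in form_values d f h s.
  have sub : {subset form_values d f h s <= iota 0 d}.
    by move=> y; rewrite mem_undup => /mapP[j _ ->]; rewrite mem_iota form_lt.
  have [|_ ->] := uniq_min_size (undup_uniq _) sub; first by rewrite sz_d size_iota.
  by rewrite mem_iota form_lt.
have [i fi Dx] := sP _ _ x_in.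
by have := form_neq neq_hf hk fi; rewrite Dx eqxx.
Qed.

(** A common value would be a meeting point, so the two value sets are disjoint subsets of the
    residues modulo [d]. *)
Lemma size_form_values_add f g s t : f != g ->
  forms_realized f s ->
  forms_realized g t ->
  size (form_values d f g s) + size (form_values d g f t) <= d.
Proof.
move=> neq_fg sP tP; rewrite -size_cat -[leqRHS](size_iota 0).
apply: uniq_leq_size.
  rewrite cat_uniq !undup_uniq andbT /=; apply/hasPn => x /tP[j gj Dx].
  apply/negP => /sP[i fi Dx']; have := form_neq neq_fg fi gj.
  by rewrite Dx Dx' eqxx.
by move=> x; rewrite mem_cat !mem_undup => /orP[] /mapP[j _ ->]; rewrite mem_iota form_lt.
Qed.

End Full.

(** * The exceptional degrees 3 and 5 *)

Definition distinct3 (f g h : pairing) : bool := [&& f != g, f != h & g != h].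

(** Up to shifts the two forms are [a - b] and [a + b]. A permutation of the residues modulo 3 is
    [b = k + a] or [b = k - a], which makes [a + b], respectively [a - b], bijective. *)
Lemma perm3_forms f g h s : distinct3 f g h -> s \in permutations (iota 0 3) ->
  (3 <= size (form_values 3 f g s)) || (3 <= size (form_values 3 f h s)).
Proof.
move=> fgh; move: s; apply/allP.
by case: f g h fgh => [] [] [] // _; vm_compute.
Qed.

(** Checked on all 120 permutations for each order of the pairings. *)
Lemma perm5_forms f g h s : distinct3 f g h -> s \in permutations (iota 0 5) ->
  (3 <= size (form_values 5 f g s)) || (5 <= size (form_values 5 f h s)).
Proof.
move=> fgh; move: s; apply/allP.
by case: f g h fgh => [] [] [] // _; vm_compute.
Qed.

(** A full pairing forces another one to be empty, leaving at most [3 + 3]; without a full pairing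
    the bound is [2 + 2 + 2]. *)
Lemma leq_skew_codes_3 n : skew_codes 3 n -> n <= 6.
Proof.
case=> c c_skew; have d_gt0 : 0 < 3 by [].
have full_empty f g h : distinct3 f g h -> #|members c f| = 3 ->
    (#|members c g| == 0) || (#|members c h| == 0).
  move=> fgh /(full_form d_gt0 c_skew)[s s_perm sP].
  have /and3P[neq_fg neq_fh neq_gh] := fgh.
  apply: contraT; rewrite negb_or -!lt0n => /andP[/card_gt0P[i gi] /card_gt0P[j hj]].
  rewrite eq_sym in neq_fg; rewrite eq_sym in neq_fh.
  have := size_form_values_lt d_gt0 c_skew neq_fg sP gi.
  have := size_form_values_lt d_gt0 c_skew neq_fh sP hj.
  by have := perm3_forms fgh s_perm; lia.
have := @full_empty XY XZ XW isT; have := @full_empty XZ XY XW isT.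
have := @full_empty XW XY XZ isT; have := sum_members c.
have := card_members d_gt0 c_skew XY; have := card_members d_gt0 c_skew XZ.
have := card_members d_gt0 c_skew XW; lia.
Qed.

(** Two full pairings leave the third empty, giving 10; otherwise the bound is [5 + 4 + 4]. For the
    former, a line in the third pairing keeps both forms facing it from being onto, so the forms
    between the full pairings take at least [3 + 3 > 5] values. *)
Lemma leq_skew_codes_5 n : skew_codes 5 n -> n <= 13.
Proof.
case=> c c_skew; have d_gt0 : 0 < 5 by [].
have full_empty f g h : distinct3 f g h -> #|members c f| = 5 -> #|members c g| = 5 ->
    #|members c h| = 0.
  move=> fgh /(full_form d_gt0 c_skew)[s s_perm sP].
  move=> /(full_form d_gt0 c_skew)[t t_perm tP].
  have /and3P[neq_fg neq_fh neq_gh] := fgh.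
  have gfh : distinct3 g f h by rewrite /distinct3 eq_sym neq_fg neq_gh.
  apply/eqP; apply: contraT; rewrite -lt0n => /card_gt0P[k hk].
  rewrite eq_sym in neq_fh; rewrite eq_sym in neq_gh.
  have := size_form_values_lt d_gt0 c_skew neq_fh sP hk.
  have := size_form_values_lt d_gt0 c_skew neq_gh tP hk.
  have := size_form_values_add d_gt0 c_skew neq_fg sP tP.
  by have := perm5_forms fgh s_perm; have := perm5_forms gfh t_perm; lia.
have := @full_empty XY XZ XW isT; have := @full_empty XY XW XZ isT.
have := @full_empty XZ XW XY isT; have := sum_members c.
have := card_members d_gt0 c_skew XY; have := card_members d_gt0 c_skew XZ.
have := card_members d_gt0 c_skew XW; lia.
Qed.

(** * Cancelling powers of linear forms *)

Local Open Scope ring_scope.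

(** In characteristic 0, ['X^n - 1] is separable, hence has [n] distinct roots, and one of these is
    primitive. *)
Lemma prim_root_exists (F : numClosedFieldType) n :
  (0 < n)%N -> exists z : F, n.-primitive_root z.
Proof.
move=> n_gt0; pose p : {poly F} := 'X^n - 1.
have [r] := closed_field_poly_normal p.
rewrite (monicP _) ?monicXnsubC // scale1r => Dp.
have rn1 : all n.-unity_root r by apply/allP=> z; rewrite -root_prod_XsubC -Dp.
have sz_r : (n < (size r).+1)%N by rewrite -(size_prod_XsubC r id) -Dp size_XnsubC.
have [|z] := hasP (has_prim_root n_gt0 rn1 _ sz_r); last by exists z.
by rewrite -separable_prod_XsubC -Dp separable_Xn_sub_1 // pnatr_eq0 -lt0n.
Qed.

Lemma poly_eq0_of_horner (F : numDomainType) (p : {poly F}) :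
  (forall t, p.[t] = 0) -> p = 0.
Proof.
move=> p0; apply/eqP; apply: contraT => p_neq0.
have := @max_poly_roots _ p [seq i%:R | i <- iota 0 (size p)] p_neq0.
rewrite size_map size_iota ltnn => -> //.
  by apply/allP => x _; rewrite rootE p0.
by rewrite map_inj_uniq ?iota_uniq // => i j /eqP; rewrite eqr_nat => /eqP.
Qed.

Section PowerSums.
Variables (F : numFieldType) (n e : nat) (c u w : 'I_n -> F).
Hypothesis pow0 : forall s t : F, \sum_j c j * (s * u j + t * w j) ^+ (e + 3) = 0.

(** At [s = 1] the power sum is a polynomial in [t] whose coefficients are these moments times
    nonzero binomials. *)
Lemma moment_eq0 k : (k <= e + 3)%N -> \sum_j c j * (u j ^+ (e + 3 - k) * w j ^+ k) = 0.
Proof.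
move=> le_k; pose m k := \sum_j c j * (u j ^+ (e + 3 - k) * w j ^+ k).
pose q := \poly_(k < (e + 3).+1) (m k *+ 'C(e + 3, k)).
suff q0 : q = 0.
  have := coef_poly (e + 3).+1 (fun k => m k *+ 'C(e + 3, k)) k.
  rewrite -/q q0 coef0 ltnS le_k => /esym/eqP.
  by rewrite mulrn_eq0 eqn0Ngt bin_gt0 le_k => /eqP.
apply: poly_eq0_of_horner => t; rewrite horner_poly -[RHS](pow0 1 t).
under [RHS]eq_bigr => j _ do rewrite mul1r exprDn mulr_sumr.
rewrite exchange_big /=; apply: eq_bigr => i _.
rewrite /m -sumrMnl mulr_suml; apply: eq_bigr => j _.
by rewrite exprMn -!mulrnAr; ring.
Qed.

(** The product of three linear forms and an [e]-th power is homogeneous of degree [e + 3] in [u j]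
    and [w j], so the sum is a combination of moments: the first four if [v = u], the last four if
    [v = w]. *)
Lemma cubic_eq0 (x y : 'I_3 -> F) (v : 'I_n -> F) : v = u \/ v = w ->
  \sum_j c j * ((\prod_k (x k * u j + y k * w j)) * v j ^+ e) = 0.
Proof.
under eq_bigr => j _ do rewrite !big_ord_recl big_ord0 mulr1.
set x0 := x _; set y0 := y _; set x1 := x _; set y1 := y _; set x2 := x _; set y2 := y _.
(* [a0], ..., [a3] are the coefficients of the expanded cubic. *)
pose a0 := x0 * x1 * x2; pose a3 := y0 * y1 * y2.
pose a1 := x0 * x1 * y2 + x0 * y1 * x2 + y0 * x1 * x2.
pose a2 := x0 * y1 * y2 + y0 * x1 * y2 + y0 * y1 * x2.
have comb k0 k1 k2 k3 : (k0 <= e + 3)%N -> (k1 <= e + 3)%N -> (k2 <= e + 3)%N ->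
    (k3 <= e + 3)%N -> let M k j := u j ^+ (e + 3 - k) * w j ^+ k in
    \sum_j c j * (a0 * M k0 j + a1 * M k1 j + a2 * M k2 j + a3 * M k3 j) = 0.
  move=> l0 l1 l2 l3 M; transitivity (a0 * (\sum_j c j * M k0 j) + a1 * (\sum_j c j * M k1 j)
    + a2 * (\sum_j c j * M k2 j) + a3 * (\sum_j c j * M k3 j)).
    rewrite !mulr_sumr -!big_split; apply: eq_bigr => j _ /=; ring.
  by rewrite !moment_eq0 // !mulr0 !addr0.
case=> ->.
- rewrite -[RHS](comb 0 1 2 3)%N; try lia.
  apply: eq_bigr => j _; congr (_ * _).
  have -> : (e + 3 - 0 = e.+3)%N by lia.
  have -> : (e + 3 - 1 = e.+2)%N by lia.
  have -> : (e + 3 - 2 = e.+1)%N by lia.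
  have -> : (e + 3 - 3 = e)%N by lia.
  by rewrite /a0 /a1 /a2 /a3 !exprS; ring.
- rewrite -[RHS](comb e e.+1 e.+2 e.+3)%N; try lia.
  apply: eq_bigr => j _; congr (_ * _).
  have -> : (e + 3 - e = 3)%N by lia.
  have -> : (e + 3 - e.+1 = 2)%N by lia.
  have -> : (e + 3 - e.+2 = 1)%N by lia.
  have -> : (e + 3 - e.+3 = 0)%N by lia.
  by rewrite /a0 /a1 /a2 /a3 !exprS; ring.
Qed.
End PowerSums.

Lemma mem_uniq4 (i j k l x : 'I_4) : uniq [:: i; j; k; l] -> x \in [:: i; j; k; l].
Proof.
move=> U; have [|_ ->] := uniq_min_size U (s2 := enum 'I_4) (fun y _ => mem_enum 'I_4 y).
  by rewrite size_enum_ord.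
by rewrite mem_enum.
Qed.

Lemma pairing4 (P : nat -> nat -> Prop) i j k l :
  (forall a b, P a b -> P b a) ->
  (i < 4)%N -> (j < 4)%N -> (k < 4)%N -> (l < 4)%N ->
  uniq [:: i; j; k; l] -> P i j -> P k l ->
  [\/ P 0%N 1%N /\ P 2%N 3%N, P 0%N 2%N /\ P 1%N 3%N | P 0%N 3%N /\ P 1%N 2%N].
Proof.
move=> Psym; case: i => [|[|[|[|//]]]] _; case: j => [|[|[|[|//]]]] _;
case: k => [|[|[|[|//]]]] _; case: l => [|[|[|[|//]]]] _ //= _ Pij Pkl;
first [ constructor 1; split; auto; fail | constructor 2; split; auto; fail
      | constructor 3; split; auto; fail].
Qed.

Section FourPoints.
Variables (F : numFieldType) (e : nat) (c u w : 'I_4 -> F).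
Hypothesis c_neq0 : forall j, c j != 0.
Hypothesis pow0 : forall s t : F, \sum_j c j * (s * u j + t * w j) ^+ (e + 3) = 0.

(** The pair [(u j, w j)] is the [j]-th linear form; [det] tests proportionality and [nz]
    nonvanishing. *)
Let det i j := u i * w j - u j * w i.
Let nz i := (u i != 0) || (w i != 0).

Let detC i j : det i j = - det j i.
Proof. by rewrite /det; ring. Qed.

Let nz_coord i : nz i -> exists2 v : 'I_4 -> F, v = u \/ v = w & v i != 0.
Proof. by case/orP => nzi; [exists u; auto | exists w; auto]. Qed.

(* Otherwise a cubic vanishing at the three other points but not at [i] would
   isolate the [i]-th term of the sum. *)
Lemma partner i : nz i -> exists j, [&& j != i, nz j & det j i == 0].
Proof.
move=> nzi; apply/existsP; apply: contraT; rewrite negb_exists => /forallP no_j.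
have [v v_uw vi] := nz_coord nzi.
pose p k := lift i k.
(* A factor vanishing at [p k] but not at [i]: a coordinate if the pair at [p k] is zero, the
   determinant with [p k] otherwise. *)
have pick (k : 'I_3) : exists xy : F * F,
    xy.1 * u (p k) + xy.2 * w (p k) = 0 /\ xy.1 * u i + xy.2 * w i != 0.
  have := no_j (p k); rewrite eq_sym neq_lift /= negb_and => /orP[|nzd].
    rewrite negb_or !negbK => /andP[/eqP u0 /eqP w0]; case/orP: nzi => nzi.
      by exists (1, 0); rewrite u0 w0 /= !mulr0 addr0 mul1r mul0r addr0.
    by exists (0, 1); rewrite u0 w0 /= !mulr0 addr0 mul1r mul0r add0r.
  exists (- w (p k), u (p k)) => /=; split; first by ring.
  by move: nzd; rewrite /det; congr (_ != 0); ring.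
have [xy xyP] := fin_all_exists pick.
have := cubic_eq0 pow0 (fun k => (xy k).1) (fun k => (xy k).2) v_uw.
rewrite (bigD1_ord i) //= [X in _ + X]big1 ?addr0 => [/eqP|k _]; last first.
  by rewrite (bigD1 k) //= (xyP k).1 !mul0r mulr0.
rewrite !mulf_eq0 (negbTE (c_neq0 i)) expf_eq0 (negbTE vi) andbF orbF /=.
by apply: contraLR => _; apply/prodf_neq0 => k _; case: (xyP k).
Qed.

(** The last equation makes the [i]-th and [j]-th terms of the power sum cancel. *)
Definition proportional i j : Prop :=
  exists a, [/\ u i = a * u j, w i = a * w j & c i * a ^+ (e + 3) + c j = 0].

Lemma proportionalC i j : proportional i j -> proportional j i.
Proof.
case=> a [ui wi eq0]; have a_neq0 : a != 0.
  apply: contraTneq (c_neq0 j) => a0; move: eq0.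
  by rewrite a0 expr0n addn_eq0 andbF mulr0 add0r => ->; rewrite eqxx.
exists a^-1; rewrite ui wi !mulKf //; split=> //.
rewrite exprVn; apply: (mulfI (expf_neq0 (e + 3) a_neq0)).
by rewrite mulr0 mulrDr mulrCA mulfV ?expf_neq0 // mulr1 addrC mulrC.
Qed.

(** The cube of [det j] kills the terms [j] and [l]. The other two contain the nonzero factor
    [det j k ^+ 3 * v k ^+ e]; dividing by it leaves the equation on [a]. *)
Lemma proportional_of i j k l : uniq [:: i; k; j; l] -> nz k -> det k i = 0 ->
  det j i != 0 -> det l j = 0 -> proportional i k.
Proof.
move=> U nzk dki dji dlj; have [v v_uw vk] := nz_coord nzk.
pose a := v i / v k.
have [ui wi] : u i = a * u k /\ w i = a * w k.
  move/eqP: dki; rewrite /det subr_eq0 => /eqP dki.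
  case: v_uw => Dv; move: vk; rewrite /a Dv => vk; split; rewrite ?mulfVK //.
    by apply: (mulfI vk); rewrite dki; field.
  by apply: (mulIf vk); rewrite -dki; field.
have djk : det j k != 0.
  apply: contraNneq dji => djk; have -> : det j i = a * det j k by rewrite /det ui wi; ring.
  by rewrite djk mulr0.
exists a; split=> //.
have := cubic_eq0 pow0 (fun=> - w j) (fun=> u j) v_uw.
have term m : - w j * u m + u j * w m = det j m by rewrite /det; ring.
under eq_bigr => m _ do under eq_bigr => s _ do rewrite term.
have ik : i != k by move: U; rewrite /= !inE; case: eqP.
rewrite (bigD1 i) //= (bigD1 k) ?[k == i]eq_sym //= [X in _ + (_ + X)]big1 ?addr0;
  last first => [m /andP[mi mk]|].
  have := mem_uniq4 m U; rewrite !inE (negbTE mi) (negbTE mk) /=.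
  suff dm : det j m = 0 -> c m * (\prod_(s < 3) det j m * v m ^+ e) = 0.
    by case/orP => /eqP Dm; apply: dm; rewrite Dm ?[det j l]detC ?dlj ?oppr0 // /det; ring.
  by move=> ->; rewrite big_ord_recl !mul0r mulr0.
rewrite !prodr_const card_ord.
have -> : det j i = a * det j k by rewrite /det ui wi; ring.
have -> : v i = a * v k by rewrite /a divfK.
move=> eq0; apply: (mulIf (expf_neq0 3 djk)); apply: (mulIf (expf_neq0 e vk)).
by rewrite !mul0r -[RHS]eq0 exprD !exprMn; ring.
Qed.

(** [i] and [j] lie in different proportionality classes, so their partners [k] and [l] are distinct
    and the four indices split as [i, k] and [j, l]. *)
Lemma four_points i j : det j i != 0 ->
  [\/ proportional (inord 0) (inord 1) /\ proportional (inord 2) (inord 3),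
      proportional (inord 0) (inord 2) /\ proportional (inord 1) (inord 3)
    | proportional (inord 0) (inord 3) /\ proportional (inord 1) (inord 2)].
Proof.
move=> dji.
have nzi : nz i.
  apply: contraNT dji; rewrite negb_or !negbK /det => /andP[/eqP-> /eqP->].
  by rewrite !mulr0 mul0r subrr.
have nzj : nz j.
  apply: contraNT dji; rewrite negb_or !negbK /det => /andP[/eqP-> /eqP->].
  by rewrite mulr0 mul0r subrr.
have [k /and3P[ki nzk /eqP dki]] := partner nzi.
have [l /and3P[lj nzl /eqP dlj]] := partner nzj.
have det_trans x y z : nz x -> det x y = 0 -> det x z = 0 -> det y z = 0.
  move=> /orP nzx dxy dxz.
  have e1 : u x * det y z = u y * det x z - u z * det x y by rewrite /det; ring.
  have e2 : w x * det y z = w y * det x z - w z * det x y by rewrite /det; ring.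
  rewrite dxy dxz !mulr0 subr0 in e1 e2.
  by case: nzx => nzx; apply: (mulfI nzx); rewrite mulr0.
have jk : j != k by apply: contraNneq dji => ->; rewrite dki.
have il : i != l.
  by apply: contraNneq dji => Di; rewrite detC Di dlj oppr0.
have kl : k != l.
  apply: contraNneq dji => Dk; rewrite -Dk in dlj.
  by rewrite (det_trans k).
have ij : i != j by apply: contraNneq dji => ->; rewrite /det subrr.
have U : uniq [:: i; k; j; l].
  by rewrite /= !inE !negb_or [i == k]eq_sym ki ij il [k == j]eq_sym jk kl [j == l]eq_sym lj.
have U' : uniq [:: j; l; i; k].
  by rewrite (uniq_catC [:: j; l] [:: i; k]).
have Pik := proportional_of U nzk dki dji dlj.
have Pjl : proportional j l.
  by apply: (proportional_of U' nzl dlj _ dki); rewrite detC oppr_eq0.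
apply: (@pairing4 (fun a b => proportional (inord a) (inord b)) i k j l) => //.
- by move=> a b; apply: proportionalC.
- by rewrite !inord_val.
- by rewrite !inord_val.
Qed.

End FourPoints.

(** * The lines of the three pairings *)

Section LinesOfPairings.
Variable F : fieldType.

Definition row4 (x y z w : F) : 'rV[F]_4 := \row_j nth 0 [:: x; y; z; w] j.

Lemma row4E x y z w : [/\ row4 x y z w 0 (inord 0) = x, row4 x y z w 0 (inord 1) = y,
  row4 x y z w 0 (inord 2) = z & row4 x y z w 0 (inord 3) = w].
Proof. by split; rewrite mxE inordK. Qed.

Lemma rV4_eq (v : 'rV[F]_4) :
  v = row4 (v 0 (inord 0)) (v 0 (inord 1)) (v 0 (inord 2)) (v 0 (inord 3)).
Proof.
apply/rowP => j; rewrite mxE -{1}(inord_val j).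
by case: j => [[|[|[|[|]]]]].
Qed.

Lemma row4_eq0 x y z w : row4 x y z w = 0 <-> [/\ x = 0, y = 0, z = 0 & w = 0].
Proof.
split=> [v0|[-> -> -> ->]].
  by have [] := row4E x y z w; rewrite v0 !mxE; split.
by apply/rowP => -[[|[|[|[|]]]] ? //]; rewrite !mxE.
Qed.

Definition on_line (f : pairing) (a b : F) (v : 'rV[F]_4) : Prop :=
  let x := v 0 (inord 0) in let y := v 0 (inord 1) in
  let z := v 0 (inord 2) in let w := v 0 (inord 3) in
  match f with
  | XY => x = a * y /\ z = b * w
  | XZ => x = a * z /\ y = b * w
  | XW => x = a * w /\ y = b * z
  end.

Lemma on_line_row4 f (a b x y z w : F) : on_line f a b (row4 x y z w) <->
  match f with
  | XY => x = a * y /\ z = b * w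
  | XZ => x = a * z /\ y = b * w
  | XW => x = a * w /\ y = b * z
  end.
Proof. by rewrite /on_line; have [-> -> -> ->] := row4E x y z w. Qed.

Definition line_mx (f : pairing) (a b : F) : 'M[F]_(2, 4) :=
  match f with
  | XY => col_mx (row4 a 1 0 0) (row4 0 0 b 1)
  | XZ => col_mx (row4 a 0 1 0) (row4 0 b 0 1)
  | XW => col_mx (row4 a 0 0 1) (row4 0 b 1 0)
  end.

Lemma row4_comb s t x y z w x' y' z' w' :
  s *: row4 x y z w + t *: row4 x' y' z' w' =
  row4 (s * x + t * x') (s * y + t * y') (s * z + t * z') (s * w + t * w').
Proof.
by rewrite [LHS](rV4_eq (_ + _)) !mxE !inordK.
Qed.

Lemma mul_col_row4 (p : 'rV[F]_(1 + 1)) (v1 v2 : 'rV[F]_4) :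
  p *m col_mx v1 v2 = p 0 (lshift 1 0) *: v1 + p 0 (rshift 1 0) *: v2.
Proof.
rewrite -{1}(hsubmxK p) mul_row_col [lsubmx p]mx11_scalar [rsubmx p]mx11_scalar.
by rewrite !mul_scalar_mx !mxE.
Qed.

Lemma sub_col_row4 (v v1 v2 : 'rV[F]_4) :
  (v <= col_mx v1 v2)%MS <-> exists s t, v = s *: v1 + t *: v2.
Proof.
split=> [/submxP[p ->]|[s [t ->]]]; first by rewrite mul_col_row4; do 2 eexists.
apply/submxP; exists (row_mx s%:M t%:M).
by rewrite mul_row_col !mul_scalar_mx.
Qed.

Lemma line_mxP f a b v : (v <= line_mx f a b)%MS <-> on_line f a b v.
Proof.
rewrite (rV4_eq v);
set x := v 0 _; set y := v 0 _; set z := v 0 _; set w := v 0 _.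
case: f; rewrite sub_col_row4; split=> [[s [t ->]]|/on_line_row4[-> ->]].
all: try (rewrite row4_comb on_line_row4; split; ring).
- by exists y, w; rewrite row4_comb; congr row4; ring.
- by exists z, w; rewrite row4_comb; congr row4; ring.
- by exists w, z; rewrite row4_comb; congr row4; ring.
Qed.

Lemma row_free_col_row4 (v1 v2 : 'rV[F]_4) :
  (forall s t, s *: v1 + t *: v2 = 0 -> s = 0 /\ t = 0) -> row_free (col_mx v1 v2).
Proof.
move=> free_v; apply: inj_row_free => p; rewrite mul_col_row4 => /free_v[p1 p2].
rewrite -(hsubmxK p) [lsubmx p]mx11_scalar [rsubmx p]mx11_scalar !mxE p1 p2.
by rewrite !raddf0 row_mx0.
Qed.

Lemma rank_line_mx f a b : \rank (line_mx f a b) = 2%N.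
Proof.
by apply/eqP; case: f; apply: row_free_col_row4 => s t; rewrite row4_comb row4_eq0;
  rewrite !mulr0 !mulr1 !(add0r, addr0) => -[].
Qed.

Lemma line_mx_eqmx (L : 'M[F]_(2, 4)) f a b : \rank L = 2%N ->
  (forall i, on_line f a b (row i L)) -> (L :=: line_mx f a b)%MS.
Proof.
move=> rL onL; have sL : (L <= line_mx f a b)%MS.
  by apply/row_subP => i; apply/line_mxP.
apply/eqmxP; rewrite sL /=; have [_ <-] := mxrank_leqif_sup sL.
by rewrite rL rank_line_mx.
Qed.

(** Supplies two nonproportional coordinate forms on the line. *)
Lemma minor_neq0 (L : 'M[F]_(2, 4)) : \rank L = 2%N ->
  exists i j, L 0 j * L 1 i - L 0 i * L 1 j != 0.
Proof.
move=> /eqP rL; suff /existsP[i /existsP[j ?]] :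
    [exists i, exists j, L 0 j * L 1 i - L 0 i * L 1 j != 0] by exists i, j.
apply: contraT; rewrite negb_exists => /forallP minor0.
have {}minor0 i j : L 0 j * L 1 i = L 0 i * L 1 j.
  by have := minor0 i; rewrite negb_exists => /forallP/(_ j); rewrite negbK subr_eq0 => /eqP.
have mulL (p : 'rV[F]_2) j : (p *m L) 0 j = p 0 0 * L 0 j + p 0 1 * L 1 j.
  rewrite mxE !big_ord_recl big_ord0 addr0.
  by congr (_ + p 0 _ * L _ _); apply: val_inj.
have free (p : 'rV[F]_2) : p *m L = 0 -> p = 0.
  by move=> /eqP; rewrite mulmx_free_eq0 // => /eqP.
have L0 i j : L i j = 0.
  (* If all minors vanish, this combination of the rows is zero, so its coefficients, column [j] of
     [L] up to sign, are zero. *)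
  have /rowP p0 : \row_k (if k == 0 then L 1 j else - L 0 j) = 0 :> 'rV[F]_2.
    by apply: free; apply/rowP => k; rewrite mulL !mxE /= mulrC minor0; ring.
  have := p0 0; have := p0 1; rewrite !mxE /= => /eqP; rewrite oppr_eq0 => /eqP L0j L1j.
  have [->|->] : i = 0 \/ i = 1; rewrite ?L0j //.
  by case: i => [[|[|]]] // ?; [left|right]; apply: val_inj.
have L_eq0 : L = 0 by apply/matrixP => i j; rewrite L0 mxE.
by rewrite L_eq0 mxrank0 in rL.
Qed.

End LinesOfPairings.

(** * When two lines given by their ratios are disjoint *)

Section Skewness.
Variable F : fieldType.
Implicit Types a b x y z w : F.

Definition apart f a b g a' b' : Prop :=
  forall v : 'rV[F]_4, on_line f a b v -> on_line g a' b' v -> v = 0.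

Lemma apartP f a b g a' b' : apart f a b g a' b' <-> forall x y z w,
  on_line f a b (row4 x y z w) -> on_line g a' b' (row4 x y z w) ->
  [/\ x = 0, y = 0, z = 0 & w = 0].
Proof.
split=> [ap x y z w onf ong|ap v]; first exact/row4_eq0/ap.
by rewrite (rV4_eq v) => onf ong; apply/row4_eq0/ap.
Qed.

Lemma apartC f a b g a' b' : apart f a b g a' b' <-> apart g a' b' f a b.
Proof. by split=> ap v onf ong; apply: ap. Qed.

Let mul_eq s t r : s != t -> s * r = t * r -> r = 0 :> F.
Proof.
by move=> neq /eqP; rewrite -subr_eq0 -mulrBl mulf_eq0 subr_eq0 (negbTE neq) => /eqP.
Qed.

Let one_neq0 : (1 : F) <> 0.
Proof. exact/eqP/oner_neq0. Qed.

(** With one common ratio, the point whose other pair of coordinates vanishes is on both lines. *)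
Lemma apart_same f a b a' b' :
  apart f a b f a' b' <-> ~~ ((a == a') || (b == b')).
Proof.
rewrite apartP; split=> [ap|].
  apply/negP => /orP[] /eqP eq_ab; apply: one_neq0.
    case: f ap => ap.
    - by have [] := ap a 1 0 0; rewrite ?on_line_row4 -?eq_ab ?mulr1 ?mulr0.
    - by have [] := ap a 0 1 0; rewrite ?on_line_row4 -?eq_ab ?mulr1 ?mulr0.
    - by have [] := ap a 0 0 1; rewrite ?on_line_row4 -?eq_ab ?mulr1 ?mulr0.
  case: f ap => ap.
  - by have [] := ap 0 0 b 1; rewrite ?on_line_row4 -?eq_ab ?mulr1 ?mulr0.
  - by have [] := ap 0 b 0 1; rewrite ?on_line_row4 -?eq_ab ?mulr1 ?mulr0.
  - by have [] := ap 0 b 1 0; rewrite ?on_line_row4 -?eq_ab ?mulr1 ?mulr0.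
rewrite negb_or => /andP[neq_a neq_b] x y z w; rewrite !on_line_row4.
by case: f => -[-> ->] [/(mul_eq neq_a)-> /(mul_eq neq_b)->]; rewrite !mulr0.
Qed.

(** At [w = 1] the equations give [y = b'], [z = b] and two values of [x]; a common point exists
    exactly when these agree. *)
Lemma apart_XY_XZ a b a' b' : apart XY a b XZ a' b' <-> a * b' != a' * b.
Proof.
rewrite apartP; split=> [ap|neq x y z w].
  apply/eqP => eq_ab; apply: one_neq0.
  have [] // := ap (a * b') b' b 1; rewrite on_line_row4 ?mulr1; split=> //.
rewrite !on_line_row4 => -[-> ->] [+ Dy]; rewrite Dy !mulrA => /(mul_eq neq)->.
by rewrite !mulr0.
Qed.

Lemma apart_XY_XW a b a' b' : apart XY a b XW a' b' <-> a * b * b' != a'.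
Proof.
rewrite apartP; split=> [ap|neq x y z w].
  apply/eqP => eq_ab; apply: one_neq0.
  have [] // := ap a' (b' * b) b 1; rewrite on_line_row4 ?mulr1 -?eq_ab; split=> //; ring.
rewrite !on_line_row4 => -[-> ->] [+ Dy]; rewrite Dy => eq_w.
have /(mul_eq neq)-> : a * b * b' * w = a' * w by rewrite -eq_w; ring.
by rewrite !mulr0.
Qed.

Lemma apart_XZ_XW a b a' b' : a != 0 -> apart XZ a b XW a' b' <-> a * b != a' * b'.
Proof.
move=> a_neq0; rewrite apartP; split=> [ap|neq x y z w].
  apply/eqP => eq_ab; move/eqP: a_neq0; apply.
  (* Scaling to [w = a] gives [z = a'] without division; [a != 0] keeps the point nonzero. *)
  have [] // := ap (a * a') (a * b) a' a; rewrite on_line_row4.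
    by split=> //; ring.
  by rewrite eq_ab; split; ring.
rewrite !on_line_row4 => -[-> ->] [eq_z eq_w].
have /(mul_eq neq) w0 : a * b * w = a' * b' * w.
  by rewrite -mulrA eq_w mulrCA eq_z; ring.
move/eqP: eq_z; rewrite w0 !mulr0 mulf_eq0 (negbTE a_neq0) => /eqP->.
by rewrite !mulr0.
Qed.

End Skewness.

(** * From ratios to exponents modulo [d] *)

Section Codes.
Variables (F : fieldType) (d : nat) (omega : F).
Let zeta := omega ^+ 2.
Hypothesis zeta_prim : d.-primitive_root zeta.

Definition ratio (f : pairing) (a : nat) : F :=
  if f is XW then omega * (omega ^+ 2) ^+ a else (omega ^+ 2) ^+ a.

Let omega_neq0 : omega != 0.
Proof.
apply/eqP => om0; have := prim_expr_order zeta_prim.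
rewrite /zeta om0 expr0n /= expr0n; have := prim_order_gt0 zeta_prim.
by case: (d) => // n _ /eqP; rewrite eq_sym oner_eq0.
Qed.

Lemma ratio_neq0 f a : ratio f a != 0.
Proof. by case: f; rewrite ?mulf_neq0 ?expf_neq0. Qed.

Lemma eq_ratio f a a' : (ratio f a == ratio f a') = (a == a' %[mod d]).
Proof.
rewrite -(eq_prim_root_expr zeta_prim) /ratio.
by case: f => //; rewrite (inj_eq (mulfI omega_neq0)).
Qed.

(** Between [XY] and [XW] one factor [omega] cancels on both sides; between [XZ] and [XW] the
    product of two is [omega ^+ 2], whence the [+ 1] in [meets]. *)
Lemma apart_meets (c c' : code) :
  apart c.1.1 (ratio c.1.1 c.1.2) (ratio c.1.1 c.2)
        c'.1.1 (ratio c'.1.1 c'.1.2) (ratio c'.1.1 c'.2) <-> ~~ meets d c c'.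
Proof.
case: c c' => [[f a] b] [[f' a'] b'] /=.
have eq_zeta i j : ((omega ^+ 2) ^+ i == (omega ^+ 2) ^+ j) = (i == j %[mod d]).
  exact: eq_prim_root_expr zeta_prim i j.
have XYXZ x y x' y' : apart XY (ratio XY x) (ratio XY y) XZ (ratio XZ x') (ratio XZ y') <->
    ~~ meets d (XY, x, y) (XZ, x', y').
  by rewrite apart_XY_XZ /ratio -!exprD eq_zeta.
have XYXW x y x' y' : apart XY (ratio XY x) (ratio XY y) XW (ratio XW x') (ratio XW y') <->
    ~~ meets d (XY, x, y) (XW, x', y').
  rewrite apart_XY_XW /ratio mulrCA (inj_eq (mulfI omega_neq0)) -!(exprD (omega ^+ 2)).
  by rewrite eq_zeta.
have XZXW x y x' y' : apart XZ (ratio XZ x) (ratio XZ y) XW (ratio XW x') (ratio XW y') <->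
    ~~ meets d (XZ, x, y) (XW, x', y').
  rewrite apart_XZ_XW ?ratio_neq0 //= /ratio.
  have -> : omega * (omega ^+ 2) ^+ x' * (omega * (omega ^+ 2) ^+ y') =
      (omega ^+ 2) ^+ (x' + y' + 1) by rewrite !exprD expr1; ring.
  by rewrite -exprD eq_zeta.
case: f f' => [] [] //; rewrite 1?apart_same ?eq_ratio //.
- by rewrite apartC XYXZ meets_sym.
- by rewrite apartC XYXW meets_sym.
- by rewrite apartC XZXW meets_sym.
Qed.

End Codes.

(** * Lines on the Fermat surface *)

Section FermatLines.
Variables (R : realType) (d : nat).
Notation C := (R[i]).
Hypothesis d_ge3 : (3 <= d)%N.
Variable omega : C.
Hypothesis omega_prim : (2 * d).-primitive_root omega.

Let zeta_prim : d.-primitive_root (omega ^+ 2).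
Proof.
have := exp_prim_root omega_prim 2.
by rewrite (gcdn_idPl (dvdn_mulr _ _)) // mulKn.
Qed.

Let omega_expd : omega ^+ d = -1.
Proof.
have := prim_expr_order omega_prim; rewrite mulnC exprM => /eqP.
rewrite sqrf_eq1 => /orP[|/eqP //].
rewrite -(prim_order_dvd omega_prim) => /dvdn_leq; lia.
Qed.

(** In the Fermat equation, [XW] pairs coordinates of equal sign, the other pairings coordinates of
    opposite sign. *)
Definition pairing_sign (f : pairing) : C := if f is XW then -1 else 1.

Lemma ratio_expd f a : ratio omega f a ^+ d = pairing_sign f.
Proof.
have z1 : ((omega ^+ 2) ^+ a) ^+ d = 1.
  by rewrite -exprM mulnC exprM (prim_expr_order zeta_prim) expr1n.
by case: f => //=; rewrite [LHS]exprMn z1 omega_expd mulr1.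
Qed.

Lemma ratio_of_expd f (a : C) : a ^+ d = pairing_sign f -> exists i, a = ratio omega f i.
Proof.
case: f => /= ad.
- by have [i ->] := prim_rootP zeta_prim ad; exists i.
- by have [i ->] := prim_rootP zeta_prim ad; exists i.
have om_neq0 : omega != 0 by have := ratio_neq0 zeta_prim XW 0; rewrite /= mulr1.
have [|i Di] := prim_rootP zeta_prim (x := a / omega).
  by rewrite expr_div_n ad omega_expd divff // oppr_eq0 oner_eq0.
by exists i; rewrite -Di mulrC divfK.
Qed.

Lemma fermat_on_line f (a b : C) v : a ^+ d = pairing_sign f ->
  b ^+ d = pairing_sign f -> on_line f a b v -> fermat_poly d v = 0.
Proof.
rewrite /fermat_poly; case: f => /= ad bd [-> ->]; rewrite !exprMn ad bd; ring.
Qed.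

Definition coord_sign (j : 'I_4) : C := nth 0 [:: 1; -1; -1; 1] j.

Lemma fermat_polyE (v : 'rV[C]_4) : fermat_poly d v = \sum_j coord_sign j * v 0 j ^+ d.
Proof.
rewrite !big_ord_recl big_ord0 /coord_sign /= /fermat_poly.
have -> : inord 0 = 0 :> 'I_4 by apply: val_inj; rewrite /= inordK.
have -> : inord 1 = lift 0 0 :> 'I_4 by apply: val_inj; rewrite /= inordK.
have -> : inord 2 = lift 0 (lift 0 0) :> 'I_4 by apply: val_inj; rewrite /= inordK.
have -> : inord 3 = lift 0 (lift 0 (lift 0 0)) :> 'I_4 by apply: val_inj; rewrite /= inordK.
by ring.
Qed.

(** On the points [s *: row 0 L + t *: row 1 L] the equation is a vanishing signed power sum of four
    linear forms, to which [four_points] applies. *)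
Lemma line_on_Fermat_pairing (L : 'M[C]_(2, 4)) : is_line L -> line_on_Fermat d L ->
  exists f (a b : C), [/\ a ^+ d = pairing_sign f, b ^+ d = pairing_sign f
    & (L :=: line_mx f a b)%MS].
Proof.
move=> rL onF; have [e De] : exists e, d = (e + 3)%N by exists (d - 3)%N; lia.
have pow0 (s t : C) : \sum_j coord_sign j * (s * L 0 j + t * L 1 j) ^+ (e + 3) = 0.
  rewrite -De -[RHS](onF (s *: row 0 L + t *: row 1 L)) ?fermat_polyE.
    by apply: eq_bigr => j _; rewrite !mxE.
  by rewrite addmx_sub ?scalemx_sub ?row_sub.
have sign_neq0 j : coord_sign j != 0.
  by case: j => [[|[|[|[|]]]]] //= ?; rewrite /coord_sign /= ?oppr_eq0 oner_eq0.
have [i [j minor]] := minor_neq0 rL.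
have rows f a b : on_line f a b (row 0 L) -> on_line f a b (row 1 L) ->
    (L :=: line_mx f a b)%MS.
  move=> on0 on1; apply: line_mx_eqmx => // k.
  have [->|->] : k = 0 \/ k = 1; rewrite //.
  by case: k => [[|[|]]] // ?; [left|right]; apply: val_inj.
have := four_points sign_neq0 pow0 minor; rewrite /proportional -De /coord_sign.
case=> -[[a [ua wa]] + [b [ub wb]]]; rewrite !inordK //= => ea eb.
- exists XY, a, b; split; last by apply: rows; rewrite /on_line !mxE.
  + by apply: subr0_eq; rewrite -[RHS]ea /=; ring.
  + by apply/esym/subr0_eq; rewrite -[RHS]eb /=; ring.
- exists XZ, a, b; split; last by apply: rows; rewrite /on_line !mxE.
  + by apply: subr0_eq; rewrite -[RHS]ea /=; ring.
  + by apply/esym/subr0_eq; rewrite -[RHS]eb /=; ring.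
- exists XW, a, b; split; last by apply: rows; rewrite /on_line !mxE.
  + by apply: subr0_eq; rewrite -[RHS]ea /=; ring.
  + by apply/esym/subr0_eq; rewrite -[RHS]eb /=; ring.
Qed.

Lemma skew_apart (L L' : 'M[C]_(2, 4)) f a b f' a' b' :
  (L :=: line_mx f a b)%MS -> (L' :=: line_mx f' a' b')%MS ->
  Defs.skew L L' <-> apart f a b f' a' b'.
Proof.
move=> eqL eqL'; rewrite /Defs.skew; split=> [/eqP|ap].
  rewrite mxrank_eq0 => /eqP cap0 v /line_mxP onv /line_mxP onv'.
  by apply/eqP; rewrite -submx0 -cap0 sub_capmx eqL eqL' onv.
apply/eqP; rewrite mxrank_eq0; apply/rowV0P => v.
by rewrite sub_capmx eqL eqL' => /andP[/line_mxP onv /line_mxP onv']; apply: ap.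
Qed.

Definition code_mx (c : code) : 'M[C]_(2, 4) :=
  line_mx c.1.1 (ratio omega c.1.1 c.1.2) (ratio omega c.1.1 c.2).

Lemma has_skew_linesP n : has_skew_lines R d n <-> skew_codes d n.
Proof.
split=> [[L [Lline Lskew]]|[c c_skew]].
  have ex i : exists c, (L i :=: code_mx c)%MS.
    have [rL onF] := Lline i.
    have [f [a [b [/ratio_of_expd[k ->] /ratio_of_expd[l ->] eqL]]]] :=
      line_on_Fermat_pairing rL onF.
    by exists (f, k, l).
  have [c eqL] := fin_all_exists ex; exists c => i j neq_ij.
  by apply/(apart_meets zeta_prim)/(skew_apart (eqL i) (eqL j))/Lskew.
exists (fun i => code_mx (c i)); split=> [i|i j /c_skew].
  split=> [|v /line_mxP]; first exact: rank_line_mx.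
  by apply: fermat_on_line; apply: ratio_expd.
by move/(apart_meets zeta_prim)/(skew_apart (eqmx_refl _) (eqmx_refl _)).
Qed.

End FermatLines.

Theorem theorem4p7 (R : realType) :
  (forall d : nat, (3 <= d)%N -> d != 3%N -> d != 5%N -> max_skew_lines R d (3 * d)) /\
  max_skew_lines R 3 6 /\ max_skew_lines R 5 13.
Proof.
(* A primitive [2 * d]-th root [omega] serves all pairings: [omega ^+ 2] generates the [d]-th roots
   of 1, and [omega] itself is a [d]-th root of -1. *)
have linesP d n : (3 <= d)%N -> has_skew_lines R d n <-> skew_codes d n.
  move=> d_ge3; have [|omega omega_prim] := @prim_root_exists R[i] (2 * d); first by lia.
  exact: has_skew_linesP omega_prim n.
rewrite /max_skew_lines; split=> [d d_ge3 d_neq3 d_neq5|].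
  split=> [|n]; rewrite linesP //.
    by apply: skew_codes_max; lia.
  by case=> c; apply: leq_skew_codes; lia.
split; split=> [|n]; rewrite linesP //.
- exact: skew_codes_3.
- exact: leq_skew_codes_3.
- exact: skew_codes_5.
- exact: leq_skew_codes_5.
Qed.
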